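(* Any element $\alpha\in E_6$ can be represented as $\alpha=\alpha_1\alpha_2\alpha_1'$ with $\alpha_1,\alpha_1'\in Spin_1(10)$ and $\alpha_2\in Spin_2(10)$.
   Context: $\mathfrak{C}$ is the (real, 8-dimensional, division) Cayley algebra of octonions with conjugation $x\mapsto\overline{x}$. $\mathfrak{J}$ is the real vector space of $3\times3$ Hermitian matrices over $\mathfrak{C}$; its elements are written $$X=(\xi_1,\xi_2,\xi_3;x_1,x_2,x_3)=\begin{pmatrix}\xi_1&x_3&\overline{x_2}\\ \overline{x_3}&\xi_2&x_1\\ x_2&\overline{x_1}&\xi_3\end{pmatrix},\quad \xi_k\in\mathbb{R},\ x_k\in\mathfrak{C}.$$ Put $X\circ Y=\frac12(XY+YX)$, $\mathrm{tr}(X)=\xi_1+\xi_2+\xi_3$, $(X,Y)=\mathrm{tr}(X\circ Y)$, and define the Freudenthal product $$X\times Y=\tfrac12\bigl(2X\circ Y-\mathrm{tr}(X)Y-\mathrm{tr}(Y)X+(\mathrm{tr}(X)\mathrm{tr}(Y)-(X,Y))E\bigr),$$ where $E$ is the unit matrix. $\mathfrak{J}^C=\mathfrak{J}\otimes_{\mathbb{R}}\mathbb{C}$ is the complexification, with all these operations extended $\mathbb{C}$-(bi)linearly (elements are written in the same way with $\xi_k\in\mathbb{C}$, $x_k\in\mathfrak{C}^C=\mathfrak{C}\otimes_{\mathbb{R}}\mathbb{C}$, octonionic conjugation being extended $\mathbb{C}$-linearly). $\tau$ is the complex conjugation of $\mathfrak{J}^C$ with respect to $\mathfrak{J}$, and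 $\langle X,Y\rangle=(\tau X,Y)$ is the resulting positive definite Hermitian inner product. $\mathrm{Iso}_{\mathbb{C}}(\mathfrak{J}^C)$ is the group of $\mathbb{C}$-linear automorphisms of the vector space $\mathfrak{J}^C$. The simply connected compact Lie group $E_6$ is $$E_6=\{\alpha\in\mathrm{Iso}_{\mathbb{C}}(\mathfrak{J}^C)\mid \alpha X\times\alpha Y=\tau\alpha\tau(X\times Y),\ \langle\alpha X,\alpha Y\rangle=\langle X,Y\rangle\text{ for all }X,Y\in\mathfrak{J}^C\}.$$ Let $E_1=(1,0,0;0,0,0)$, $E_2=(0,1,0;0,0,0)$. For $k=1,2$, $Spin_k(10)=\{\alpha\in E_6\mid\alpha E_k=E_k\}$ (a subgroup isomorphic to the usual spinor group $Spin(10)$). *)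

(* Defs.v *)
From HB Require Import structures.
From mathcomp Require Import all_boot all_order all_algebra.
From mathcomp Require Import ring.
From mathcomp Require Export complex.
From mathcomp Require Import reals.

Set Implicit Arguments.
Unset Strict Implicit.
Unset Printing Implicit Defensive.

Import GRing.Theory.
Local Open Scope ring_scope.

(* Octonions and Hermitian matrices are defined with coefficients in a field K:
   K = R gives the real Cayley algebra and the real space J, while K = R[i]
   gives their complexifications, with all operations extended C-(bi)linearly.
   In particular conjugation of octonions never conjugates the coefficients. *)

Section CayleyDickson.
Variables (A : zmodType) (conj : A -> A) (mul : A -> A -> A).

(* (a + b e)(c + d e) = (a c - conj d b) + (b conj c + d a) e *)
Definition cd_mul (x y : A * A) : A * A :=
  (mul x.1 y.1 - mul (conj y.2) x.2, mul x.2 (conj y.1) + mul y.2 x.1).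

Definition cd_conj (x : A * A) : A * A := (conj x.1, - x.2).

End CayleyDickson.

Section Cayley.
Variable K : fieldType.

(* Three Cayley-Dickson doublings of K.  The product types below also carry the
   componentwise ring structure of MathComp, which is never used: products of
   octonions are always written omul. *)
Definition dbl1 : vectType K := (K^o * K^o)%type.
Definition dbl2 : vectType K := (dbl1 * dbl1)%type.
Definition oct : vectType K := (dbl2 * dbl2)%type.

Definition conj1 : dbl1 -> dbl1 := @cd_conj K id.
Definition mul1 : dbl1 -> dbl1 -> dbl1 := @cd_mul K id *%R.
Definition conj2 : dbl2 -> dbl2 := cd_conj conj1.
Definition mul2 : dbl2 -> dbl2 -> dbl2 := cd_mul conj1 mul1.
Definition oconj : oct -> oct := cd_conj conj2.
Definition omul : oct -> oct -> oct := cd_mul conj2 mul2.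

Definition oscal (k : K) : oct := (((k, 0), 0), 0).
Definition ore (x : oct) : K := x.1.1.1.

Definition onorm (x : oct) : K := ore (omul x (oconj x)).

Lemma omul_oconj (x : oct) : omul x (oconj x) = oscal (onorm x).
Proof.
case: x => [[[a0 a1] [a2 a3]] [[a4 a5] [a6 a7]]].
rewrite /onorm /omul /oconj /oscal /ore /mul2 /mul1 /conj2 /conj1.
by rewrite /cd_mul /cd_conj /=; do ![congr pair] => /=; ring.
Qed.

(* The norm is a sum of eight squares, so for K = R the next lemma makes the
   algebra a division algebra. *)
Lemma onormE (x : oct) :
  onorm x = x.1.1.1 ^+ 2 + x.1.1.2 ^+ 2 + x.1.2.1 ^+ 2 + x.1.2.2 ^+ 2
          + x.2.1.1 ^+ 2 + x.2.1.2 ^+ 2 + x.2.2.1 ^+ 2 + x.2.2.2 ^+ 2.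
Proof.
case: x => [[[a0 a1] [a2 a3]] [[a4 a5] [a6 a7]]].
rewrite /onorm /omul /oconj /ore /mul2 /mul1 /conj2 /conj1.
by rewrite /cd_mul /cd_conj /=; ring.
Qed.

Lemma onormM (x y : oct) : onorm (omul x y) = onorm x * onorm y.
Proof.
rewrite !onormE.
case: x => [[[a0 a1] [a2 a3]] [[a4 a5] [a6 a7]]].
case: y => [[[b0 b1] [b2 b3]] [[b4 b5] [b6 b7]]].
rewrite /omul /mul2 /mul1 /conj2 /conj1 /cd_mul /cd_conj /=; ring.
Qed.

End Cayley.

Section Jordan.
Variable K : fieldType.

(* Elements (xi1, xi2, xi3; x1, x2, x3). *)
Definition J : vectType K := (K^o * K^o * K^o * (oct K * oct K * oct K))%type.

Definition mkJ (a b c : K) (x y z : oct K) : J := ((a, b, c), (x, y, z)).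

Definition xi1 (X : J) : K := X.1.1.1.
Definition xi2 (X : J) : K := X.1.1.2.
Definition xi3 (X : J) : K := X.1.2.
Definition x1 (X : J) : oct K := X.2.1.1.
Definition x2 (X : J) : oct K := X.2.1.2.
Definition x3 (X : J) : oct K := X.2.2.

Definition i1 : 'I_3 := @Ordinal 3 0 isT.
Definition i2 : 'I_3 := @Ordinal 3 1 isT.
Definition i3 : 'I_3 := @Ordinal 3 2 isT.

Definition jmat (X : J) : 'M[oct K]_3 :=
  \matrix_(i, j) nth 0 (nth [::]
    [:: [:: oscal (xi1 X);  x3 X;            oconj (x2 X) ];
        [:: oconj (x3 X);   oscal (xi2 X);   x1 X         ];
        [:: x2 X;           oconj (x1 X);    oscal (xi3 X)]] i) j.

(* Inverse of jmat on Hermitian matrices, see jmatK and matjK. *)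
Definition matj (M : 'M[oct K]_3) : J :=
  mkJ (ore (M i1 i1)) (ore (M i2 i2)) (ore (M i3 i3))
      (M i2 i3) (M i3 i1) (M i1 i2).

Definition hermitian_oct (M : 'M[oct K]_3) : Prop :=
  forall i j, M i j = oconj (M j i).

Definition omulmx (M N : 'M[oct K]_3) : 'M[oct K]_3 :=
  \matrix_(i, j) \sum_k omul (M i k) (N k j).

Definition jordan (X Y : J) : J :=
  2^-1 *: matj (omulmx (jmat X) (jmat Y) + omulmx (jmat Y) (jmat X)).

Definition jtr (X : J) : K := xi1 X + xi2 X + xi3 X.

Definition jform (X Y : J) : K := jtr (jordan X Y).

Definition jE : J := mkJ 1 1 1 0 0 0.

Definition freudenthal (X Y : J) : J :=
  2^-1 *: (2 *: jordan X Y - jtr X *: Y - jtr Y *: X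
           + (jtr X * jtr Y - jform X Y) *: jE).

Definition jE1 : J := mkJ 1 0 0 0 0 0.
Definition jE2 : J := mkJ 0 1 0 0 0 0.

Lemma ord3P (P : 'I_3 -> Prop) : P i1 -> P i2 -> P i3 -> forall i, P i.
Proof.
move=> P1 P2 P3 [[|[|[|//]]] lti].
- by rewrite (_ : Ordinal lti = i1) //; apply: val_inj.
- by rewrite (_ : Ordinal lti = i2) //; apply: val_inj.
- by rewrite (_ : Ordinal lti = i3) //; apply: val_inj.
Qed.

Lemma jmatK : cancel jmat matj.
Proof. by case=> [[[a b] c] [[x y] z]]; rewrite /matj !mxE. Qed.

Lemma oconjK : involutive (@oconj K).
Proof.
case=> [[[a0 a1] [a2 a3]] [[a4 a5] [a6 a7]]].
by rewrite /oconj /conj2 /conj1 /cd_conj /= !opprK.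
Qed.

Lemma oconj_scal k : oconj (oscal k) = oscal k :> oct K.
Proof. by rewrite /oconj /conj2 /conj1 /cd_conj /= !oppr0. Qed.

Lemma jmat_herm X : hermitian_oct (jmat X).
Proof.
by apply: ord3P; apply: ord3P; rewrite !mxE /= ?oconjK ?oconj_scal.
Qed.

Lemma oconj_fix (x : oct K) : (2 : K) != 0 -> x = oconj x -> oscal (ore x) = x.
Proof.
move=> nz2; case: x => [[[a0 a1] [a2 a3]] [[a4 a5] [a6 a7]]].
have N0 (a : K) : a = - a -> 0 = a.
  move=> aN; apply/esym/eqP; have /eqP: 2 * a = 0.
    by rewrite mulr_natl mulr2n {2}aN subrr.
  by rewrite mulf_eq0 (negPf nz2).
by case=> /N0<- /N0<- /N0<- /N0<- /N0<- /N0<- /N0<-.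
Qed.

Lemma matjK M : (2 : K) != 0 -> hermitian_oct M -> jmat (matj M) = M.
Proof.
move=> nz2 hM; apply/matrixP.
by apply: ord3P; apply: ord3P; rewrite !mxE /=; try exact/oconj_fix/hM;
  rewrite -?hM.
Qed.

Lemma oconjD : {morph @oconj K : x y / x + y}.
Proof.
move=> [[[a0 a1] [a2 a3]] [[a4 a5] [a6 a7]]].
move=> [[[b0 b1] [b2 b3]] [[b4 b5] [b6 b7]]].
rewrite /oconj /conj2 /conj1 /cd_conj /=.
by do ![congr pair] => /=; rewrite ?opprD.
Qed.

Lemma oconjM (x y : oct K) : oconj (omul x y) = omul (oconj y) (oconj x).
Proof.
case: x => [[[a0 a1] [a2 a3]] [[a4 a5] [a6 a7]]].
case: y => [[[b0 b1] [b2 b3]] [[b4 b5] [b6 b7]]].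
rewrite /omul /oconj /mul2 /mul1 /conj2 /conj1 /cd_mul /cd_conj /=.
by do ![congr pair] => /=; ring.
Qed.

Lemma oconj0 : oconj 0 = 0 :> oct K.
Proof. exact: (oconj_scal 0). Qed.

Lemma oconjZ (k : K) (x : oct K) : oconj (k *: x) = k *: oconj x.
Proof.
by rewrite /oconj /conj2 /conj1 /cd_conj; do ![congr pair]; rewrite /= ?scalerN.
Qed.

Lemma omulmx_conj M N i j : hermitian_oct M -> hermitian_oct N ->
  oconj (omulmx M N i j) = omulmx N M j i.
Proof.
move=> hM hN; rewrite !mxE (big_morph _ oconjD oconj0).
by apply: eq_bigr => k _; rewrite oconjM -hM -hN.
Qed.

Lemma jordanE X Y : (2 : K) != 0 ->
  jmat (jordan X Y) =
  \matrix_(i, j) (2^-1 *: (omulmx (jmat X) (jmat Y)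
                           + omulmx (jmat Y) (jmat X)) i j).
Proof.
move=> nz2; have hX := jmat_herm X; have hY := jmat_herm Y.
rewrite /jordan; move: (jmat X) (jmat Y) hX hY => M N hM hN.
have hS : hermitian_oct (omulmx M N + omulmx N M).
  have addE (A B : 'M[oct K]_3) i j : (A + B) i j = A i j + B i j.
    by rewrite mxE.
  by move=> i j; rewrite !addE oconjD !omulmx_conj // addrC.
move: (omulmx M N + omulmx N M) hS => S hS.
rewrite -[RHS]matjK //; last by move=> i j; rewrite !mxE hS oconjZ.
by congr jmat; rewrite /matj !mxE.
Qed.

End Jordan.

Arguments jE {K}.
Arguments jE1 {K}.
Arguments jE2 {K}.

Section E6.
(* The real numbers are an arbitrary realType R, the complex numbers are R[i]. *)
Variable R : realType.

Definition JC : vectType R[i] := J R[i].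

(* tau and octtau conjugate the complex coefficients, so their fixed points are
   the elements with coefficients in R. *)
Definition octtau (x : oct R[i]) : oct R[i] :=
  let c := @conjc R in
  (((c x.1.1.1, c x.1.1.2), (c x.1.2.1, c x.1.2.2)),
   ((c x.2.1.1, c x.2.1.2), (c x.2.2.1, c x.2.2.2))).

Definition tau (X : JC) : JC :=
  mkJ (conjc (xi1 X)) (conjc (xi2 X)) (conjc (xi3 X))
      (octtau (x1 X)) (octtau (x2 X)) (octtau (x3 X)).

Definition jherm (X Y : JC) : R[i] := jform (tau X) Y.

Definition IsoC (alpha : 'End(JC)) : Prop := bijective alpha.

Definition E6 (alpha : 'End(JC)) : Prop :=
  [/\ IsoC alpha,
      forall X Y : JC, freudenthal (alpha X) (alpha Y)
                       = tau (alpha (tau (freudenthal X Y)))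
    & forall X Y : JC, jherm (alpha X) (alpha Y) = jherm X Y].

Definition Spin1_10 (alpha : 'End(JC)) : Prop := E6 alpha /\ alpha jE1 = jE1.
Definition Spin2_10 (alpha : 'End(JC)) : Prop := E6 alpha /\ alpha jE2 = jE2.

End E6.

(* Main.v *)
(* It suffices to bring X = alpha E1, which satisfies X x X = 0 and <X, X> = 1,
   back to E1 by some f in Spin_1(10) followed by some g in Spin_2(10): then
   g f alpha fixes E1.  Three explicit families of elements of E6 are used: the
   maps X |-> A X A^T for A in SU(2) acting on the indices 2 and 3, the maps
   (x1, x2, x3) |-> (conj a x1, x2 conj a, a x3 a) for real unit octonions a,
   and the cyclic permutation of the indices.  The first two fix E1.

   Under Spin_1(10), the equations xi2 = 0 and x1 = 0 are reached as follows:
   an octonion map makes the real part of x1 a scalar, an element of SU(2)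
   kills that real part, and an octonion map makes the remaining imaginary part
   a scalar.  Now xi2, x1, xi3 form a complex symmetric 2 x 2 matrix of
   determinant 0 (as X x X = 0), that is w w^T with w in C^2, and SU(2) rotates
   w to the last basis vector.  If then xi3 <> 0, the equation X x X = 0 forces
   x3 = 0.  If xi3 = 0, then x2 and x3 are null octonions with x2 x3 = 0; an
   octonion map makes x3 and conj x2 parallel, and SU(2) kills x3.  What is
   left is (xi1, 0, xi3; 0, x2, 0), to which the first reduction applies with
   the indices permuted cyclically; its result is E1 because <X, X> = 1. *)

From HB Require Import structures.
Require Import Defs.
From mathcomp Require Import all_boot all_order all_algebra.
From mathcomp Require Import ring.
From mathcomp Require Import reals.

Set Implicit Arguments.
Unset Strict Implicit.
Unset Printing Implicit Defensive.

Import Order.TTheory GRing.Theory Num.Theory.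
Local Open Scope ring_scope.

(** * Octonions in coordinates *)

Section Octonions.
Variable K : fieldType.
Implicit Types (k : K) (a x y z : oct K).

Definition mkO (a0 a1 a2 a3 a4 a5 a6 a7 : K) : oct K :=
  (((a0, a1), (a2, a3)), ((a4, a5), (a6, a7))).

Lemma mkO_ind (P : oct K -> Prop) :
  (forall a0 a1 a2 a3 a4 a5 a6 a7 : K, P (mkO a0 a1 a2 a3 a4 a5 a6 a7)) ->
  forall x, P x.
Proof. by move=> H [[[a0 a1] [a2 a3]] [[a4 a5] [a6 a7]]]; apply: H. Qed.

Definition odot x y : K :=
  x.1.1.1 * y.1.1.1 + x.1.1.2 * y.1.1.2 + x.1.2.1 * y.1.2.1 + x.1.2.2 * y.1.2.2
  + x.2.1.1 * y.2.1.1 + x.2.1.2 * y.2.1.2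
  + x.2.2.1 * y.2.2.1 + x.2.2.2 * y.2.2.2.

(* Copies of the vector space operations on octonions.  Rewriting with oaddE
   would otherwise try to unify the structure of oct K with that of K at each
   sum of coordinates. *)
Definition oadd x y : oct K := x + y.
Definition oopp x : oct K := - x.
Definition oscale k x : oct K := k *: x.
Definition ozero : oct K := 0.

Section Coordinates.
Variables a0 a1 a2 a3 a4 a5 a6 a7 b0 b1 b2 b3 b4 b5 b6 b7 : K.
Let a := mkO a0 a1 a2 a3 a4 a5 a6 a7.
Let b := mkO b0 b1 b2 b3 b4 b5 b6 b7.

Lemma omulE : omul a b =
  mkO
    (a0 * b0 - a1 * b1 - a2 * b2 - a3 * b3
     - a4 * b4 - a5 * b5 - a6 * b6 - a7 * b7)
    (a0 * b1 + a1 * b0 + a2 * b3 - a3 * b2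
     + a4 * b5 - a5 * b4 - a6 * b7 + a7 * b6)
    (a0 * b2 - a1 * b3 + a2 * b0 + a3 * b1
     + a4 * b6 + a5 * b7 - a6 * b4 - a7 * b5)
    (a0 * b3 + a1 * b2 - a2 * b1 + a3 * b0
     + a4 * b7 - a5 * b6 + a6 * b5 - a7 * b4)
    (a0 * b4 - a1 * b5 - a2 * b6 - a3 * b7
     + a4 * b0 + a5 * b1 + a6 * b2 + a7 * b3)
    (a0 * b5 + a1 * b4 - a2 * b7 + a3 * b6
     - a4 * b1 + a5 * b0 - a6 * b3 + a7 * b2)
    (a0 * b6 + a1 * b7 + a2 * b4 - a3 * b5
     - a4 * b2 + a5 * b3 + a6 * b0 - a7 * b1)
    (a0 * b7 - a1 * b6 + a2 * b5 + a3 * b4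
     - a4 * b3 - a5 * b2 + a6 * b1 + a7 * b0).
Proof.
have pD (U V : zmodType) (p r : U) (q s : V) :
  (p, q) + (r, s) = (p + r, q + s) by [].
have pN (U V : zmodType) (p : U) (q : V) : - (p, q) = (- p, - q) by [].
rewrite /a /b /omul /mul2 /mul1 /conj2 /conj1 /cd_mul /cd_conj /mkO /=.
rewrite !(pD, pN) /=.
by congr (_ , _); congr (_ , _); congr (_ , _); ring.
Qed.

Lemma oconjE :
  oconj a = mkO a0 (- a1) (- a2) (- a3) (- a4) (- a5) (- a6) (- a7).
Proof. by []. Qed.

Lemma oaddE : oadd a b = mkO (a0 + b0) (a1 + b1) (a2 + b2) (a3 + b3)
                             (a4 + b4) (a5 + b5) (a6 + b6) (a7 + b7).
Proof. by []. Qed.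

Lemma ooppE :
  oopp a = mkO (- a0) (- a1) (- a2) (- a3) (- a4) (- a5) (- a6) (- a7).
Proof. by []. Qed.

Lemma oscaleE k : oscale k a = mkO (k * a0) (k * a1) (k * a2) (k * a3)
                                   (k * a4) (k * a5) (k * a6) (k * a7).
Proof. by []. Qed.

Lemma odotE : odot a b =
  a0 * b0 + a1 * b1 + a2 * b2 + a3 * b3 + a4 * b4 + a5 * b5 + a6 * b6 + a7 * b7.
Proof. by []. Qed.

Lemma oreE : ore a = a0. Proof. by []. Qed.

End Coordinates.

Lemma oscalE k : oscal k = mkO k 0 0 0 0 0 0 0. Proof. by []. Qed.
Lemma ozeroE : ozero = mkO 0 0 0 0 0 0 0 0. Proof. by []. Qed.

Definition octE :=
  (omulE, oconjE, oaddE, ooppE, oscaleE, odotE, oreE, oscalE, ozeroE).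

End Octonions.

Ltac oct_fold :=
  repeat match goal with
  | |- context [?x + ?y] =>
    match type of x with context [oct] => change (x + y) with (oadd x y) end
  | |- context [- ?x] =>
    match type of x with context [oct] => change (- x) with (oopp x) end
  | |- context [?k *: ?x] =>
    match type of x with context [oct] => change (k *: x) with (oscale k x) end
  | |- context [@GRing.zero ?V] =>
    match V with context [oct ?K] => change (@GRing.zero V) with (ozero K) end
  end.

(** The octonion product is not associative, so no ring normal form exists at the level of
    octonions. Identities are split into their eight coordinates, where they become commutative
    polynomial identities. *)
Ltac oct_ring :=
  oct_fold;
  repeat match goal with
  | x : Vector.sort (oct _) |- _ =>
    move: x; elim/mkO_ind => ? ? ? ? ? ? ? ?
  end;
  rewrite !octE; try congr mkO; ring.

(** * Identities of the octonion product *)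

Section OctonionIdentities.
Variable K : fieldType.
Implicit Types (k l : K) (a x y z : oct K).

Lemma onorm_odot x : onorm x = odot x x.
Proof. by rewrite onormE !expr2. Qed.

(** The three Moufang identities. The last two are stated with [oconj a], so that for a unit [a] the
    three give the [x3], [x2] and [x1] components, in this order, of [octmap_freudenthal]. *)
Lemma moufang_middle a x y :
  omul (omul a x) (omul y a) = omul a (omul (omul x y) a).
Proof. oct_ring. Qed.

Lemma moufang_left a x y :
  omul (omul a (omul x a)) (omul (oconj a) y) = odot a a *: omul a (omul x y).
Proof. oct_ring. Qed.

Lemma moufang_right a x y :
  omul (omul x (oconj a)) (omul a (omul y a)) = odot a a *: omul (omul x y) a.
Proof. oct_ring. Qed.

Lemma flexible a x : omul (omul a x) a = omul a (omul x a).
Proof. oct_ring. Qed.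

Lemma odot_conj x y : odot (oconj x) (oconj y) = odot x y.
Proof. oct_ring. Qed.

Lemma odotMl a x y : odot (omul a x) (omul a y) = odot a a * odot x y.
Proof. oct_ring. Qed.

Lemma odotMr a x y : odot (omul x a) (omul y a) = odot a a * odot x y.
Proof. by rewrite -odot_conj !oconjM odotMl !odot_conj. Qed.

Lemma omul_oscal k x : omul (oscal k) x = k *: x.
Proof. oct_ring. Qed.

Lemma omulDl x y z : omul (x + y) z = omul x z + omul y z.
Proof. oct_ring. Qed.

Lemma omulDr x y z : omul x (y + z) = omul x y + omul x z.
Proof. oct_ring. Qed.

Lemma omulNl x y : omul (- x) y = - omul x y.
Proof. oct_ring. Qed.

Lemma omulNr x y : omul x (- y) = - omul x y.
Proof. oct_ring. Qed.

Lemma omulZl k x y : omul (k *: x) y = k *: omul x y.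
Proof. oct_ring. Qed.

Lemma omulZr k x y : omul x (k *: y) = k *: omul x y.
Proof. oct_ring. Qed.

Lemma odotZZ k x : odot (k *: x) (k *: x) = k ^+ 2 * odot x x.
Proof. oct_ring. Qed.

Lemma omul_conj_self a : omul (oconj a) a = oscal (odot a a).
Proof. oct_ring. Qed.

Lemma odot_oscal k : odot (oscal k) (oscal k) = k ^+ 2.
Proof. oct_ring. Qed.

(** Polarisation in p of the identity [omulK_conj]. *)
Lemma omul_alt_swap p q z :
  omul p (omul (oconj q) z) + omul q (omul (oconj p) z) = (2 * odot p q) *: z.
Proof. oct_ring. Qed.

Lemma omulK_conj p z : omul p (omul (oconj p) z) = odot p p *: z.
Proof. oct_ring. Qed.

Lemma oscalZ k l : k *: oscal l = oscal (k * l) :> oct K.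
Proof. oct_ring. Qed.

Lemma oscalD k l : oscal (k + l) = oscal k + oscal l :> oct K.
Proof. oct_ring. Qed.

Lemma oscalB k l : oscal (k - l) = oscal k - oscal l :> oct K.
Proof. oct_ring. Qed.

Lemma odot_addZ k x y : odot (x + k *: y) (x + k *: y)
  = odot x x + k ^+ 2 * odot y y + k * (2 * odot x y).
Proof. oct_ring. Qed.

(** Applied with [j = 'i] and [j' = - 'i]: it pulls the factor i out of the [x1] entry of an SU(2)
    image, whose scalar part c + (u - v) r will be purely imaginary. *)
Lemma oct_factor (j j' c r u v : K) y : j * j' = 1 ->
  oscal c + u *: (oscal r + j *: y) - v *: oconj (oscal r + j *: y)
  = j *: (oscal (j' * (c + (u - v) * r)) + u *: y - v *: oconj y).
Proof.
move=> jj'; rewrite [RHS]scalerBr [j *: (oscal _ + _)]scalerDr oscalZ.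
rewrite mulrA jj' mul1r; clear; oct_ring.
Qed.

Lemma omul0o x : omul 0 x = 0.
Proof. oct_ring. Qed.

Lemma omulo0 x : omul x 0 = 0.
Proof. oct_ring. Qed.

Lemma odot0o x : odot 0 x = 0.
Proof. oct_ring. Qed.

Lemma odoto0 x : odot x 0 = 0.
Proof. oct_ring. Qed.

End OctonionIdentities.

(** * The Freudenthal product in coordinates *)

Section Freudenthal.
Variable K : fieldType.
Implicit Types (k : K) (X Y : J K).

Lemma mkJ_ind (P : J K -> Prop) :
  (forall (a b c : K) (x y z : oct K), P (mkJ a b c x y z)) -> forall X, P X.
Proof. by move=> H [[[a b] c] [[x y] z]]; apply: H. Qed.

Lemma sum3E (V : zmodType) (F : 'I_3 -> V) : \sum_k F k = F i1 + F i2 + F i3.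
Proof.
rewrite !big_ord_recl big_ord0 addr0 addrA.
by do !congr (_ + _); congr F; apply: val_inj.
Qed.

Lemma omulmxE (M N : 'M[oct K]_3) i j : omulmx M N i j =
  omul (M i i1) (N i1 j) + omul (M i i2) (N i2 j) + omul (M i i3) (N i3 j).
Proof. by rewrite mxE sum3E. Qed.

Lemma xi1D X Y : xi1 (X + Y) = xi1 X + xi1 Y. Proof. exact: erefl. Qed.
Lemma xi1N X : xi1 (- X) = - xi1 X. Proof. exact: erefl. Qed.
Lemma xi1Z k X : xi1 (k *: X) = k * xi1 X. Proof. exact: erefl. Qed.
Lemma xi2D X Y : xi2 (X + Y) = xi2 X + xi2 Y. Proof. exact: erefl. Qed.
Lemma xi2N X : xi2 (- X) = - xi2 X. Proof. exact: erefl. Qed.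
Lemma xi2Z k X : xi2 (k *: X) = k * xi2 X. Proof. exact: erefl. Qed.
Lemma xi3D X Y : xi3 (X + Y) = xi3 X + xi3 Y. Proof. exact: erefl. Qed.
Lemma xi3N X : xi3 (- X) = - xi3 X. Proof. exact: erefl. Qed.
Lemma xi3Z k X : xi3 (k *: X) = k * xi3 X. Proof. exact: erefl. Qed.
Lemma x1D X Y : x1 (X + Y) = x1 X + x1 Y. Proof. exact: erefl. Qed.
Lemma x1N X : x1 (- X) = - x1 X. Proof. exact: erefl. Qed.
Lemma x1Z k X : x1 (k *: X) = k *: x1 X. Proof. exact: erefl. Qed.
Lemma x2D X Y : x2 (X + Y) = x2 X + x2 Y. Proof. exact: erefl. Qed.
Lemma x2N X : x2 (- X) = - x2 X. Proof. exact: erefl. Qed.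
Lemma x2Z k X : x2 (k *: X) = k *: x2 X. Proof. exact: erefl. Qed.
Lemma x3D X Y : x3 (X + Y) = x3 X + x3 Y. Proof. exact: erefl. Qed.
Lemma x3N X : x3 (- X) = - x3 X. Proof. exact: erefl. Qed.
Lemma x3Z k X : x3 (k *: X) = k *: x3 X. Proof. exact: erefl. Qed.

Definition jlinE :=
  ((xi1D, xi1N, xi1Z), (xi2D, xi2N, xi2Z), (xi3D, xi3N, xi3Z),
   (x1D, x1N, x1Z), (x2D, x2N, x2Z), (x3D, x3N, x3Z)).

Lemma jext X Y : xi1 X = xi1 Y -> xi2 X = xi2 Y -> xi3 X = xi3 Y ->
  x1 X = x1 Y -> x2 X = x2 Y -> x3 X = x3 Y -> X = Y.
Proof.
elim/mkJ_ind: X => a b c x y z; elim/mkJ_ind: Y => a' b' c' x' y' z'.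
by rewrite /xi1 /xi2 /xi3 /x1 /x2 /x3 /= => -> -> -> -> -> ->.
Qed.

Lemma mkJ_eq (a b c a' b' c' : K) (x y z x' y' z' : oct K) :
  a = a' -> b = b' -> c = c' -> x = x' -> y = y' -> z = z' ->
  mkJ a b c x y z = mkJ a' b' c' x' y' z'.
Proof. by move=> -> -> -> -> -> ->. Qed.

Lemma jscaleE k (a b c : K) (x y z : oct K) :
  k *: mkJ a b c x y z = mkJ (k * a) (k * b) (k * c) (k *: x) (k *: y) (k *: z).
Proof. exact: erefl. Qed.

Section Coordinates.
Variables (a b c : K) (x y z : oct K).
Let X := mkJ a b c x y z.

Lemma jproj : ((xi1 X = a) * (xi2 X = b) * (xi3 X = c))
  * ((x1 X = x) * (x2 X = y) * (x3 X = z)).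
Proof. by []. Qed.

Lemma jmatE :
  (((jmat X i1 i1 = oscal a) * (jmat X i1 i2 = z) * (jmat X i1 i3 = oconj y))
   * ((jmat X i2 i1 = oconj z) * (jmat X i2 i2 = oscal b) * (jmat X i2 i3 = x))
   * ((jmat X i3 i1 = y) * (jmat X i3 i2 = oconj x)
      * (jmat X i3 i3 = oscal c)))%type.
Proof. by do !split; rewrite /jmat mxE. Qed.

End Coordinates.

Lemma add_omulmxE (M N : 'M[oct K]_3) i j :
  (omulmx M N + omulmx N M) i j =
  omul (M i i1) (N i1 j) + omul (M i i2) (N i2 j) + omul (M i i3) (N i3 j)
  + (omul (N i i1) (M i1 j) + omul (N i i2) (M i2 j) + omul (N i i3) (M i3 j)).
Proof. by rewrite mxE !omulmxE. Qed.

Lemma jordan_mkJ (a b c a' b' c' : K) (x y z x' y' z' : oct K) :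
  (2 : K) != 0 ->
  jordan (mkJ a b c x y z) (mkJ a' b' c' x' y' z') =
  mkJ (a * a' + odot y y' + odot z z') (b * b' + odot z z' + odot x x')
      (c * c' + odot x x' + odot y y')
      (2^-1 *: (oconj (omul y z' + omul y' z)
               + (b + c) *: x' + (b' + c') *: x))
      (2^-1 *: (oconj (omul z x' + omul z' x)
               + (c + a) *: y' + (c' + a') *: y))
      (2^-1 *: (oconj (omul x y' + omul x' y)
               + (a + b) *: z' + (a' + b') *: z)).
Proof.
move=> nz2; rewrite /jordan /matj !add_omulmxE !jmatE.
apply: jext; rewrite !(jlinE, jproj).
1-3: apply: (mulfI nz2); rewrite mulVKf //.
4-6: congr (_ *: _).
all: clear nz2; oct_ring.
Qed.

Lemma jform_mkJ (a b c a' b' c' : K) (x y z x' y' z' : oct K) :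
  (2 : K) != 0 -> jform (mkJ a b c x y z) (mkJ a' b' c' x' y' z') =
  a * a' + b * b' + c * c' + 2 * (odot x x' + odot y y' + odot z z').
Proof. by move=> nz2; rewrite /jform jordan_mkJ // /jtr !jproj; ring. Qed.

Lemma freudenthal_mkJ (a b c a' b' c' : K) (x y z x' y' z' : oct K) :
  (2 : K) != 0 -> freudenthal (mkJ a b c x y z) (mkJ a' b' c' x' y' z') =
  2^-1 *: mkJ (b * c' + c * b' - 2 * odot x x')
      (c * a' + a * c' - 2 * odot y y')
      (a * b' + b * a' - 2 * odot z z')
      (oconj (omul y z' + omul y' z) - a *: x' - a' *: x)
      (oconj (omul z x' + omul z' x) - b *: y' - b' *: y)
      (oconj (omul x y' + omul x' y) - c *: z' - c' *: z).
Proof.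
move=> nz2; rewrite /freudenthal; congr (_ *: _).
rewrite jform_mkJ // jordan_mkJ // /jtr !jproj /jE.
apply: jext; rewrite !(jlinE, jproj) ?scalerA ?divff ?scale1r //; clear nz2.
- ring.
- ring.
- ring.
- oct_ring.
- oct_ring.
- oct_ring.
Qed.

End Freudenthal.

(** * Linear maps of J compatible with the Freudenthal product *)

Section Generators.
Variable K : fieldType.
Implicit Types (k p q r s : K) (a : oct K) (X Y : J K).

(* X |-> A X A^T for the scalar matrix A = [[1,0,0],[0,p,q],[0,r,s]] *)
Definition row23 p q r s X : J K :=
  mkJ (xi1 X)
      (p ^+ 2 * xi2 X + 2 * (p * q) * ore (x1 X) + q ^+ 2 * xi3 X)
      (r ^+ 2 * xi2 X + 2 * (r * s) * ore (x1 X) + s ^+ 2 * xi3 X)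
      (oscal (p * r * xi2 X + q * s * xi3 X)
       + (p * s) *: x1 X + (q * r) *: oconj (x1 X))
      (r *: oconj (x3 X) + s *: x2 X)
      (p *: x3 X + q *: oconj (x2 X)).

(* For unit a, the triality triple attached to a by the Moufang identities. *)
Definition octmap a X : J K :=
  mkJ (xi1 X) (xi2 X) (xi3 X) (omul (oconj a) (x1 X)) (omul (x2 X) (oconj a))
      (omul a (omul (x3 X) a)).

Definition cyc X : J K := mkJ (xi2 X) (xi3 X) (xi1 X) (x2 X) (x3 X) (x1 X).

Lemma row23_linear p q r s : linear (row23 p q r s).
Proof.
move=> k X Y.
elim/mkJ_ind: X => a b c x y z; elim/mkJ_ind: Y => a' b' c' x' y' z'.
rewrite /row23; apply: jext; rewrite !(jlinE, jproj).
- by [].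
- by oct_ring.
- by oct_ring.
- by oct_ring.
- by oct_ring.
- by oct_ring.
Qed.

HB.instance Definition _ p q r s :=
  GRing.isLinear.Build K (J K) (J K) _ (row23 p q r s) (row23_linear p q r s).

Lemma octmap_linear a : linear (octmap a).
Proof.
move=> k X Y.
elim/mkJ_ind: X => b c d x y z; elim/mkJ_ind: Y => b' c' d' x' y' z'.
rewrite /octmap; apply: jext; rewrite !(jlinE, jproj).
1-3: exact: erefl.
- by rewrite omulDr omulZr.
- by rewrite omulDl omulZl.
- by rewrite omulDl omulZl omulDr omulZr.
Qed.

HB.instance Definition _ a :=
  GRing.isLinear.Build K (J K) (J K) _ (octmap a) (octmap_linear a).

Lemma cyc_linear : linear cyc.
Proof.
have cycD X Y : cyc (X + Y) = cyc X + cyc Y by exact: erefl.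
have cycZ k X : cyc (k *: X) = k *: cyc X by exact: erefl.
by move=> k X Y; rewrite cycD cycZ.
Qed.

HB.instance Definition _ :=
  GRing.isLinear.Build K (J K) (J K) _ cyc cyc_linear.

Hypothesis nz2 : (2 : K) != 0.

(** X x X is the adjugate of X, and for det A = 1 the adjugate of A X A^T is A^{-T} adj(X) A^{-1}.
    The entries s, - r, - q, p are those of A^{-T}. *)
Lemma row23_freudenthal p q r s X Y : p * s - q * r = 1 ->
  freudenthal (row23 p q r s X) (row23 p q r s Y)
  = row23 s (- r) (- q) p (freudenthal X Y).
Proof.
elim/mkJ_ind: X => a b c x y z; elim/mkJ_ind: Y => a' b' c' x' y' z' d1.
(* For an arbitrary matrix, the left-hand side has an extra factor det^2 in [xi1] and det in [x2]
   and [x3]. Inserting these factors on the right turns every component into a polynomial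
   identity. *)
have d2 k : k = (p * s - q * r) ^+ 2 * k by rewrite d1 expr1n mul1r.
have dZ (w : oct K) : w = (p * s - q * r) *: w by rewrite d1 scale1r.
rewrite {1 2}/row23 !freudenthal_mkJ // [RHS]linearZ; congr (_ *: _).
rewrite /row23; apply: jext; rewrite !(jlinE, jproj).
- rewrite [RHS]d2; clear.
  oct_ring.
- clear.
  oct_ring.
- clear.
  oct_ring.
- clear.
  oct_ring.
- rewrite [RHS]dZ; clear.
  oct_ring.
- rewrite [RHS]dZ; clear.
  oct_ring.
Qed.

(** With A^{-T} acting on one side, this is tr(A^{-T} X A^{-1} A Y A^T) = tr(X Y). *)
Lemma row23_jform p q r s X Y : p * s - q * r = 1 ->
  jform (row23 s (- r) (- q) p X) (row23 p q r s Y) = jform X Y.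
Proof.
elim/mkJ_ind: X => a b c x y z; elim/mkJ_ind: Y => a' b' c' x' y' z' d1.
rewrite /row23 !jform_mkJ // !jproj.
have -> : a * a' + b * b' + c * c' + 2 * (odot x x' + odot y y' + odot z z')
  = a * a' + (p * s - q * r) ^+ 2 * (b * b' + c * c' + 2 * odot x x')
    + (p * s - q * r) * (2 * (odot y y' + odot z z')).
  by rewrite d1 expr1n; ring.
clear; oct_ring.
Qed.

Lemma octmap_freudenthal a X Y : odot a a = 1 ->
  freudenthal (octmap a X) (octmap a Y) = octmap a (freudenthal X Y).
Proof.
elim/mkJ_ind: X => b c d x y z; elim/mkJ_ind: Y => b' c' d' x' y' z' d1.
have d1' : odot (oconj a) (oconj a) = 1 by rewrite odot_conj.
rewrite {1 2}/octmap !freudenthal_mkJ // [RHS]linearZ; congr (_ *: _).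
rewrite /octmap; apply: jext; rewrite !(jlinE, jproj).
- by rewrite odotMl d1' mul1r.
- by rewrite odotMr d1' mul1r.
- by rewrite odotMl odotMr d1 !mul1r.
- rewrite !moufang_right d1 !scale1r -omulDl oconjM.
  by rewrite !(omulDr, omulNr, omulZr).
- rewrite !moufang_left d1 !scale1r -omulDr oconjM.
  by rewrite !(omulDl, omulNl, omulZl).
- rewrite !moufang_middle -omulDr -omulDl !oconjM oconjK flexible.
  by rewrite 2!(omulDl _ _ a) 2!omulNl 2!omulZl 2!(omulDr a) 2!omulNr 2!omulZr.
Qed.

Lemma octmap_jform a X Y : odot a a = 1 ->
  jform (octmap a X) (octmap a Y) = jform X Y.
Proof.
elim/mkJ_ind: X => b c d x y z; elim/mkJ_ind: Y => b' c' d' x' y' z' d1.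
rewrite /octmap !jform_mkJ // !jproj.
by rewrite !odotMl !odotMr odot_conj d1 !mul1r.
Qed.

Lemma cyc_freudenthal X Y :
  freudenthal (cyc X) (cyc Y) = cyc (freudenthal X Y).
Proof.
elim/mkJ_ind: X => b c d x y z; elim/mkJ_ind: Y => b' c' d' x' y' z'.
rewrite {1 2}/cyc; do 2!rewrite (freudenthal_mkJ _ _ _ _ _ _ _ _ _ _ _ _ nz2).
rewrite [RHS]linearZ.
exact: erefl.
Qed.

Lemma cyc_jform X Y : jform (cyc X) (cyc Y) = jform X Y.
Proof.
elim/mkJ_ind: X => b c d x y z; elim/mkJ_ind: Y => b' c' d' x' y' z'.
by rewrite /cyc !jform_mkJ // !jproj; ring.
Qed.

Lemma rank1E (a b c : K) (x y z : oct K) :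
  freudenthal (mkJ a b c x y z) (mkJ a b c x y z) = 0 ->
  [/\ b * c = odot x x, c * a = odot y y, a * b = odot z z,
      oconj (omul y z) = a *: x & oconj (omul x y) = c *: z].
Proof.
rewrite (freudenthal_mkJ _ _ _ _ _ _ _ _ _ _ _ _ nz2) => /eqP.
rewrite scaler_eq0 invr_eq0 (negPf nz2) /= => /eqP V0.
have half (u v : K) : u + u - 2 * v = 0 -> u = v.
  by move=> e; apply: (mulfI nz2); apply/subr0_eq; rewrite -e; ring.
have ohalf (u w : oct K) : oconj (u + u) - w - w = 0 -> oconj u = w.
  move=> e; apply: (scalerI nz2); apply: subr0_eq; rewrite -e.
  clear; oct_ring.
have := congr1 (@xi1 K) V0; rewrite jproj [c * b]mulrC => /half xi1V.
have := congr1 (@xi2 K) V0; rewrite jproj [a * c]mulrC => /half xi2V.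
have := congr1 (@xi3 K) V0; rewrite jproj [b * a]mulrC => /half xi3V.
have := congr1 (@x1 K) V0; rewrite jproj => /ohalf x1V.
have := congr1 (@x3 K) V0; rewrite jproj => /ohalf x3V.
by split.
Qed.

Lemma freudenthal_jE1 (a b c : K) (x y z : oct K) :
  freudenthal jE1 (mkJ a b c x y z) =
  mkJ 0 (2^-1 * c) (2^-1 * b) (2^-1 *: - x) 0 0.
Proof.
rewrite /jE1 (freudenthal_mkJ _ _ _ _ _ _ _ _ _ _ _ _ nz2) jscaleE.
rewrite !odot0o !omul0o !omulo0 !addr0 !scale0r !scaler0 !mulr0 !mul0r.
rewrite oconj0 scale1r !subr0 !sub0r !addr0 !mul1r.
by apply: mkJ_eq; rewrite ?oppr0 ?mulr0 ?scaler0 ?add0r.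
Qed.

(* The projection of J onto {(0, b, c; x, 0, 0)}; being built from E1 and the
   Freudenthal product only, it commutes with Spin_1(10). *)
Definition peirce X : J K := 4 *: freudenthal jE1 (freudenthal jE1 X).

Lemma peirceE (a b c : K) (x y z : oct K) :
  peirce (mkJ a b c x y z) = mkJ 0 b c x 0 0.
Proof.
have e4 : 4 * (2^-1 * 2^-1) = 1 :> K.
  by rewrite (natrM K 2 2) mulrACA divff // mul1r.
rewrite /peirce !freudenthal_jE1 jscaleE.
apply: mkJ_eq.
- exact: mulr0.
- by rewrite [X in 4 * X]mulrA mulrA e4 mul1r.
- by rewrite [X in 4 * X]mulrA mulrA e4 mul1r.
- by rewrite !scalerN opprK !scalerA e4 scale1r.
- exact: scaler0.
- exact: scaler0.
Qed.

End Generators.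

(** * Complex conjugation *)

Section ComplexStructure.
Variable R : realType.
Local Notation C := R[i].
Local Notation conj := (@conjc R).
Implicit Types (X Y : JC R) (x y z : oct C) (k : C).

Lemma two_neq0 : (2 : C) != 0. Proof. by rewrite pnatr_eq0. Qed.

Lemma mul_conj_ge0 k : 0 <= k * conj k.
Proof. by rewrite -[k * _]normCK exprn_ge0. Qed.

Lemma mul_conj_eq0 k : (k * conj k == 0) = (k == 0).
Proof. by rewrite -[k * _]normCK expf_eq0 normr_eq0. Qed.

Lemma conjc_fix k : 0 <= k -> conj k = k.
Proof. by move=> k0; apply: (geC0_conj k0). Qed.

Lemma octtauE a0 a1 a2 a3 a4 a5 a6 a7 :
  octtau (mkO a0 a1 a2 a3 a4 a5 a6 a7 : oct C) =
  mkO (conj a0) (conj a1) (conj a2) (conj a3)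
      (conj a4) (conj a5) (conj a6) (conj a7).
Proof. by []. Qed.

Lemma octtauK : involutive (@octtau R).
Proof. by elim/mkO_ind => *; rewrite !octtauE !conjcK. Qed.

Lemma octtauD x y : octtau (x + y) = octtau x + octtau y.
Proof.
oct_fold; elim/mkO_ind: x => *; elim/mkO_ind: y => *.
by rewrite octE !octtauE octE; congr mkO; ring.
Qed.

Lemma octtauN x : octtau (- x) = - octtau x.
Proof.
oct_fold; elim/mkO_ind: x => *.
by rewrite octE !octtauE octE; congr mkO; ring.
Qed.

Lemma octtauZ k x : octtau (k *: x) = conj k *: octtau x.
Proof.
oct_fold; elim/mkO_ind: x => *.
by rewrite octE !octtauE octE; congr mkO; ring.
Qed.

Lemma octtau_conj x : octtau (oconj x) = oconj (octtau x).
Proof.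
elim/mkO_ind: x => *.
by rewrite octE !octtauE octE; congr mkO; ring.
Qed.

Lemma octtauM x y : octtau (omul x y) = omul (octtau x) (octtau y).
Proof.
elim/mkO_ind: x => *; elim/mkO_ind: y => *.
by rewrite omulE !octtauE omulE; congr mkO; ring.
Qed.

Lemma odot_tau x y : odot (octtau x) (octtau y) = conj (odot x y).
Proof.
elim/mkO_ind: x => *; elim/mkO_ind: y => *.
by rewrite !octtauE !octE; ring.
Qed.

Lemma ore_tau x : ore (octtau x) = conj (ore x).
Proof. by []. Qed.

Lemma octtau_scal k : octtau (oscal k) = oscal (conj k).
Proof. by rewrite !oscalE octtauE !rmorph0. Qed.

Lemma octtau0 : octtau 0 = 0 :> oct C.
Proof. by rewrite -(scale0r (0 : oct C)) octtauZ rmorph0 !scale0r. Qed.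

Lemma tau_mkJ (a b c : C) x y z :
  tau (mkJ a b c x y z) =
  mkJ (conj a) (conj b) (conj c) (octtau x) (octtau y) (octtau z).
Proof. by []. Qed.

Lemma tauK : involutive (@tau R).
Proof. by elim/mkJ_ind => *; rewrite !tau_mkJ !conjcK !octtauK. Qed.

Lemma tauZ k X : tau (k *: X) = conj k *: tau X.
Proof.
elim/mkJ_ind: X => a b c x y z; rewrite jscaleE !tau_mkJ jscaleE.
by rewrite !octtauZ; congr mkJ; ring.
Qed.

Lemma tau_freudenthal X Y : tau (freudenthal X Y) = freudenthal (tau X) (tau Y).
Proof.
elim/mkJ_ind: X => a b c x y z; elim/mkJ_ind: Y => a' b' c' x' y' z'.
rewrite (tau_mkJ a b c) (tau_mkJ a' b' c').
rewrite !(freudenthal_mkJ _ _ _ _ _ _ _ _ _ _ _ _ two_neq0) tauZ.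
rewrite fmorphV rmorph_nat tau_mkJ; congr (_ *: _).
rewrite !octtauD !octtauN !octtauZ !octtau_conj !octtauD !octtauM !odot_tau.
by congr mkJ; ring.
Qed.

Lemma tau_row23 (p q r s : C) X :
  tau (row23 p q r s X) = row23 (conj p) (conj q) (conj r) (conj s) (tau X).
Proof.
elim/mkJ_ind: X => a b c x y z; rewrite /row23 !tau_mkJ !jproj.
rewrite !octtauD !octtauZ !octtau_conj octtau_scal !ore_tau.
apply: mkJ_eq; [exact: erefl | ring | ring | | exact: erefl | exact: erefl].
by rewrite (rmorphM _ p s) (rmorphM _ q r) rmorphD !rmorphM.
Qed.

Lemma tau_octmap (a : oct C) X : octtau a = a ->
  tau (octmap a X) = octmap a (tau X).
Proof.
elim/mkJ_ind: X => b c d x y z ra; rewrite /octmap !tau_mkJ !jproj.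
by rewrite !octtauM !octtau_conj ra.
Qed.

Lemma tau_cyc X : tau (cyc X) = cyc (tau X).
Proof. by []. Qed.

End ComplexStructure.

(** * The group E6 and some of its elements *)

Section E6Group.
Variable R : realType.
Local Notation C := R[i].
Local Notation conj := (@conjc R).
Implicit Types (X Y : JC R) (x y : oct C) (k : C) (f g : 'End(JC R)).

Lemma odot_tau_ge0 x : 0 <= odot (octtau x) x.
Proof.
elim/mkO_ind: x => *; rewrite octtauE odotE.
by rewrite !addr_ge0 // mulrC mul_conj_ge0.
Qed.

Lemma odot_tau_eq0 x : odot (octtau x) x = 0 -> x = 0.
Proof.
elim/mkO_ind: x => a0 a1 a2 a3 a4 a5 a6 a7; rewrite octtauE odotE => /eqP.
rewrite !paddr_eq0 ?addr_ge0 // ?[conj _ * _]mulrC ?mul_conj_ge0 //.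
rewrite !mul_conj_eq0.
by do 7![case/andP]; do 8!move/eqP->.
Qed.

Lemma jherm_mkJ (a b c a' b' c' : C) (x y z x' y' z' : oct C) :
  jherm (mkJ a b c x y z) (mkJ a' b' c' x' y' z') =
  conj a * a' + conj b * b' + conj c * c'
  + 2 * (odot (octtau x) x' + odot (octtau y) y' + odot (octtau z) z').
Proof. exact: jform_mkJ (two_neq0 R). Qed.

Lemma jherm_eq0 X : jherm X X = 0 -> X = 0.
Proof.
elim/mkJ_ind: X => a b c x y z; rewrite jherm_mkJ => /eqP.
have ge0 k : 0 <= conj k * k by rewrite mulrC mul_conj_ge0.
have sum_eq0 (u v : C) : 0 <= u -> 0 <= v -> u + v == 0 -> u = 0 /\ v = 0.
  by move=> u0 v0; rewrite paddr_eq0 // => /andP[/eqP-> /eqP->].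
have s0 : 0 <= odot (octtau x) x + odot (octtau y) y.
  by rewrite addr_ge0 ?odot_tau_ge0.
case/sum_eq0.
- by rewrite !addr_ge0.
- by rewrite mulr_ge0 // addr_ge0 // odot_tau_ge0.
move=> /eqP/sum_eq0[]; rewrite ?addr_ge0 // => /eqP/sum_eq0[] // + + + /eqP.
have conj0 k : conj k * k = 0 -> k = 0.
  by move/eqP; rewrite mulrC mul_conj_eq0 => /eqP.
move=> /conj0-> /conj0-> /conj0->; rewrite mulf_eq0 (negPf (two_neq0 R)) /=.
case/sum_eq0; rewrite ?odot_tau_ge0 // => /eqP/sum_eq0[].
- exact: odot_tau_ge0.
- exact: odot_tau_ge0.
by move=> /odot_tau_eq0-> /odot_tau_eq0-> /odot_tau_eq0->.
Qed.

(** Positive definiteness of [jherm] makes the kernel trivial, which suffices in finite dimension.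
    Membership in [E6] thus reduces to the two identities of [E6_intro]. *)
Lemma isometry_bij f :
  (forall X, jherm (f X) (f X) = jherm X X) -> bijective f.
Proof.
move=> isof; have /eqP ker0 : lker f == 0%VS.
  apply/eqP/vspaceP => X; rewrite memv_ker memv0; apply/eqP/eqP=> [fX0 | ->].
    apply: jherm_eq0; rewrite -isof fX0.
    have -> : (0 : JC R) = mkJ 0 0 0 0 0 0 by exact: erefl.
    by rewrite jherm_mkJ !odoto0 !mulr0 !addr0 mulr0 addr0.
  exact: linear0.
by exists (f^-1)%VF; [apply/lker0_lfunK/eqP | apply/lker0_lfunVK/eqP].
Qed.

Lemma E6_intro f :
  (forall X Y, freudenthal (f X) (f Y) = tau (f (tau (freudenthal X Y)))) ->
  (forall X Y, jherm (f X) (f Y) = jherm X Y) -> E6 f.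
Proof. by move=> fF fH; split=> //; apply: isometry_bij. Qed.

Lemma E6_comp f g : E6 f -> E6 g -> E6 (f \o g)%VF.
Proof.
move=> [_ fF fH] [_ gF gH]; apply: E6_intro => X Y; rewrite !comp_lfunE.
  by rewrite fF gF tauK.
by rewrite fH gH.
Qed.

Lemma E6_invK f : E6 f -> cancel (f^-1)%VF f /\ cancel f (f^-1)%VF.
Proof.
move=> [/bij_inj injf _ _]; have ker0 : lker f == 0%VS by apply/lker0P.
by split; [apply: lker0_lfunVK | apply: lker0_lfunK].
Qed.

Lemma E6_inv f : E6 f -> E6 (f^-1)%VF.
Proof.
move=> Ef; have [fVK fK] := E6_invK Ef; case: Ef => _ fF fH.
apply: E6_intro => X Y; last by rewrite -fH !fVK.
by rewrite -{2}[X]fVK -{2}[Y]fVK fF tauK fK tauK.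
Qed.

Lemma E6_id : E6 (\1%VF : 'End(JC R)).
Proof. by apply: E6_intro => X Y; rewrite !id_lfunE ?tauK. Qed.

Lemma Spin1_comp f g : Spin1_10 f -> Spin1_10 g -> Spin1_10 (f \o g)%VF.
Proof.
move=> [Ef f1] [Eg g1]; split; first exact: E6_comp.
by rewrite comp_lfunE g1.
Qed.

Lemma Spin1_inv f : Spin1_10 f -> Spin1_10 (f^-1)%VF.
Proof.
move=> [Ef f1]; split; first exact: E6_inv.
by rewrite -[in LHS]f1 (E6_invK Ef).2.
Qed.

Lemma E6_rank1 f X : E6 f -> freudenthal X X = 0 -> freudenthal (f X) (f X) = 0.
Proof.
have tau0 : tau 0 = 0 :> JC R.
  by rewrite -(scale0r (0 : JC R)) tauZ rmorph0 !scale0r.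
by case=> _ fF _ X0; rewrite fF X0 tau0 linear0 tau0.
Qed.

(** * Explicit elements of E6 *)

Definition su2_map (a b : C) : 'End(JC R) :=
  linfun (row23 a (- conj b) b (conj a)).

Lemma su2_mapE a b : su2_map a b =1 row23 a (- conj b) b (conj a).
Proof. exact: lfunE. Qed.

(** For A in SU(2), A^{-T} is the complex conjugate of A, so the contragredient map in
    [row23_freudenthal] is exactly the twist by [tau] required in [E6]. *)
Lemma su2_map_Spin1 a b : a * conj a + b * conj b = 1 -> Spin1_10 (su2_map a b).
Proof.
move=> ab1; have d1 : a * conj a - - conj b * b = 1 by rewrite -ab1; ring.
have tauE X : tau (row23 a (- conj b) b (conj a) X)
              = row23 (conj a) (- b) (conj b) a (tau X).
  have cNb : conj (- conj b) = - b by rewrite raddfN /= conjcK.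
  by rewrite tau_row23 conjcK cNb.
split.
  apply: E6_intro => X Y.
    rewrite (su2_mapE a b X) (su2_mapE a b Y) (su2_mapE a b (tau _)) tauE tauK.
    by rewrite (row23_freudenthal (two_neq0 R) X Y d1) opprK.
  rewrite /jherm (su2_mapE a b X) (su2_mapE a b Y) tauE.
  rewrite -(row23_jform (two_neq0 R) (tau X) Y d1) opprK.
  exact: erefl.
rewrite (su2_mapE a b jE1) /row23 /jE1; apply: mkJ_eq; rewrite ?jproj; clear.
- exact: erefl.
- oct_ring.
- oct_ring.
- oct_ring.
- oct_ring.
- oct_ring.
Qed.

Definition oct_map (a : oct C) : 'End(JC R) := linfun (octmap a).

Lemma oct_mapE (a : oct C) : oct_map a =1 octmap a.
Proof. exact: lfunE. Qed.

Lemma oct_map_Spin1 (a : oct C) : octtau a = a -> odot a a = 1 ->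
  Spin1_10 (oct_map a).
Proof.
move=> ra a1; split.
  apply: E6_intro => X Y.
    rewrite (oct_mapE a X) (oct_mapE a Y) (oct_mapE a (tau _)).
    rewrite (tau_octmap _ ra) tauK.
    exact: (octmap_freudenthal (two_neq0 R) X Y a1).
  rewrite /jherm (oct_mapE a X) (oct_mapE a Y) (tau_octmap _ ra).
  exact: (octmap_jform (two_neq0 R) (tau X) Y a1).
rewrite (oct_mapE a jE1) /octmap /jE1; apply: mkJ_eq; rewrite ?jproj; clear.
- exact: erefl.
- exact: erefl.
- exact: erefl.
- exact: omulo0.
- exact: omul0o.
- by rewrite omul0o omulo0.
Qed.

Definition cyc_map : 'End(JC R) := linfun (@cyc C).

Lemma cyc_mapE : cyc_map =1 @cyc C.
Proof. exact: lfunE. Qed.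

Lemma cyc_map_E6 : E6 cyc_map.
Proof.
apply: E6_intro => X Y.
  rewrite (cyc_mapE X) (cyc_mapE Y) (cyc_mapE (tau _)) tau_cyc tauK.
  exact: (cyc_freudenthal (two_neq0 R) X Y).
rewrite /jherm (cyc_mapE X) (cyc_mapE Y) tau_cyc.
exact: (cyc_jform (two_neq0 R) (tau X) Y).
Qed.

(** One product with E1 turns f into its twist by [tau]. As E1 is real, it is fixed by that twist
    too, and the second product turns the twist back into f. *)
Lemma peirce_Spin1 f X : Spin1_10 f -> peirce (f X) = f (peirce X).
Proof.
case=> [[_ fF _] f1].
have tau1 : tau jE1 = jE1 :> JC R.
  rewrite /jE1 tau_mkJ; apply: mkJ_eq.
  - exact: rmorph1.
  - exact: rmorph0.
  - exact: rmorph0.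
  - exact: octtau0.
  - exact: octtau0.
  - exact: octtau0.
have tfF Y Z : freudenthal (tau (f (tau Y))) (tau (f (tau Z)))
               = f (freudenthal Y Z).
  by rewrite -tau_freudenthal fF tauK tau_freudenthal !tauK.
have mulE1 : freudenthal jE1 (f X) = tau (f (tau (freudenthal jE1 X))).
  by rewrite -fF f1.
have tmulE1 Z : freudenthal jE1 (tau (f (tau Z))) = f (freudenthal jE1 Z).
  by rewrite -tfF tau1 f1 tau1.
by rewrite /peirce mulE1 tmulE1 [RHS]linearZ.
Qed.

End E6Group.

(** * Scalar equations over the complex numbers *)

Section Scalars.
Variable R : realType.
Local Notation C := R[i].
Local Notation conj := (@conjc R).
Implicit Types (k l m a b w z t : C).

Lemma conj_i : conj 'i = - 'i.
Proof. exact: conjCi. Qed.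

Lemma normalize_pair a b : (a != 0) || (b != 0) ->
  exists l, [/\ 0 < l, conj l = l & l ^+ 2 * (a * conj a + b * conj b) = 1].
Proof.
move=> ab0; set n := a * conj a + b * conj b.
have n_gt0 : 0 < n.
  rewrite lt_neqAle eq_sym addr_ge0 ?mul_conj_ge0 // andbT.
  by rewrite paddr_eq0 ?mul_conj_ge0 // !mul_conj_eq0 negb_and.
have s_gt0 : 0 < sqrtC n by rewrite sqrtC_gt0.
exists (sqrtC n)^-1; split.
- by rewrite invr_gt0.
- by apply: conjc_fix; rewrite invr_ge0 ltW.
- by rewrite exprVn sqrtCK mulVf // gt_eqF.
Qed.

(** The expression is the value at the vector (a, conj b) of a Hermitian form with diagonal entries
    2t, - 2t and off-diagonal entries m, conj m. Its trace is zero, so it is zero or indefinite and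
    has an isotropic unit vector. *)
Lemma traceless_isotropic m t : conj t = t ->
  exists a b, a * conj a + b * conj b = 1 /\
    a * b * m + conj (a * b * m) + 2 * (a * conj a - b * conj b) * t = 0.
Proof.
move=> tr.
suff [a [b [ab0 abm]]] : exists a b, ((a != 0) || (b != 0)) /\
    a * b * m + conj (a * b * m) + 2 * (a * conj a - b * conj b) * t = 0.
  have [l [_ lr l1]] := normalize_pair ab0.
  exists (l * a), (l * b); rewrite !rmorphM /= lr; split.
    by rewrite -l1; ring.
  rewrite -[RHS](mulr0 (l ^+ 2)) -abm !rmorphM /=; ring.
have [-> | m0] := eqVneq m 0.
  by exists 1, 1; rewrite oner_neq0 rmorph1 mulr0 rmorph0; split=> //; ring.
have [-> | t0] := eqVneq t 0.
  by exists 1, 0; rewrite oner_neq0 !mulr0 mul0r rmorph0; split=> //; ring.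
have two0 := two_neq0 R.
(* With b = conj m and a = u real, the equation is twice t u^2 + N u - N t = 0. Its discriminant N^2
   + 4 N t^2 is nonnegative, so it has the real root u = (d - N) / (2 t). *)
set N := m * conj m.
have N_ge0 : 0 <= N := mul_conj_ge0 m.
have Nr : conj N = N := conjc_fix N_ge0.
have D_ge0 : 0 <= N ^+ 2 + 4 * N * t ^+ 2.
  have t2 : 0 <= t ^+ 2 by rewrite expr2 -{2}tr mul_conj_ge0.
  have N4_ge0 := mulr_ge0 (ler0n _ 4) N_ge0.
  exact: (addr_ge0 (exprn_ge0 2 N_ge0) (mulr_ge0 N4_ge0 t2)).
pose d := sqrtC (N ^+ 2 + 4 * N * t ^+ 2).
have dr : conj d = d by apply: conjc_fix; rewrite sqrtC_ge0.
have d2 : d ^+ 2 = N ^+ 2 + 4 * N * t ^+ 2 by rewrite sqrtCK.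
have [u [ur uN]] : exists u, conj u = u /\ u * N + u ^+ 2 * t - N * t = 0.
  exists ((d - N) / (2 * t)); split.
    have c2t : conj (2 * t) = 2 * t by rewrite -[in RHS]tr; ring.
    have -> : conj ((d - N) / (2 * t)) = (conj d - conj N) / conj (2 * t).
      by rewrite -fmorphV -rmorphB -rmorphM.
    by rewrite c2t dr Nr.
  have -> : forall M,
      (d - M) / (2 * t) * M + ((d - M) / (2 * t)) ^+ 2 * t - M * t
      = (d ^+ 2 - (M ^+ 2 + 4 * M * t ^+ 2)) / (4 * t).
    by move=> M; field; rewrite t0.
  by rewrite d2 subrr mul0r.
exists u, (conj m); split; first by rewrite conjc_eq0 m0 orbT.
rewrite !rmorphM /= conjcK ur.
transitivity (2 * (u * N + u ^+ 2 * t - N * t)); first by rewrite /N; ring.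
by rewrite uN mulr0.
Qed.

Lemma sym_rank1 b c z : b * c = z ^+ 2 ->
  exists w1 w2, [/\ b = w1 ^+ 2, c = w2 ^+ 2 & z = w1 * w2].
Proof.
move=> bc; have : (sqrtC b * sqrtC c) ^+ 2 == z ^+ 2.
  by rewrite exprMn !sqrtCK bc.
rewrite eqf_sqr => /orP[] /eqP e.
  by exists (sqrtC b), (sqrtC c); rewrite !sqrtCK e.
by exists (sqrtC b), (- sqrtC c); rewrite sqrrN !sqrtCK mulrN e opprK.
Qed.

(** The matrix with rows (a, - conj b) and (b, conj a) takes (w1, w2) to (0, norm) once its second
    row is the normalised conjugate of (w1, w2). *)
Lemma su2_align w1 w2 : exists a b,
  [/\ a * conj a + b * conj b = 1, a * w1 - conj b * w2 = 0
    & 0 <= b * w1 + conj a * w2].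
Proof.
have [|] := boolP ((w1 != 0) || (w2 != 0)); last first.
  rewrite negb_or !negbK => /andP[/eqP-> /eqP->].
  exists 1, 0; rewrite rmorph1 rmorph0.
  by split; rewrite ?mulr0 ?subrr ?addr0 ?mulr1.
move=> /normalize_pair[l [l0 lr l1]].
exists (l * w2), (l * conj w1); rewrite !rmorphM /= conjcK lr; split.
- by rewrite -l1; ring.
- by ring.
- have -> : l * conj w1 * w1 + l * conj w2 * w2
              = l * (w1 * conj w1 + w2 * conj w2).
    by ring.
  by rewrite mulr_ge0 ?addr_ge0 ?mul_conj_ge0 ?ltW.
Qed.

End Scalars.

(** * Reduction of rank-one elements *)

Section Reduction.
Variable R : realType.
Local Notation C := R[i].
Local Notation conj := (@conjc R).
Implicit Types (X Y : JC R) (p q x y z : oct C) (a b k : C).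

Lemma real_imag_oct x :
  exists p q, [/\ octtau p = p, octtau q = q & x = p + 'i *: q].
Proof.
have nz2 := two_neq0 R; have nzi := neq0Ci C.
have conj2V : conj 2^-1 = 2^-1 by rewrite fmorphV rmorph_nat.
have conjNiV : conj (- ('i * 2^-1)) = 'i * 2^-1.
  rewrite rmorphN rmorphM [X in _ * X]conj2V [X in X * _]conj_i.
  by rewrite mulNr opprK.
exists (2^-1 *: (x + octtau x)), ((- ('i * 2^-1)) *: (x - octtau x)); split.
- by rewrite octtauZ octtauD octtauK addrC conj2V.
- rewrite octtauZ octtauD octtauN octtauK conjNiV.
  by rewrite -[x - _]opprB scalerN scaleNr opprK.
- rewrite scalerA mulrN mulrA -expr2 sqrCi mulN1r opprK -scalerDr.
  rewrite addrACA subrr addr0 -mulr2n -[x *+ 2]scaler_nat.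
  by rewrite scalerA mulVf // scale1r.
Qed.

Lemma real_imag_eq0 p q : octtau p = p -> octtau q = q ->
  p + 'i *: q = 0 -> p = 0 /\ q = 0.
Proof.
move=> rp rq pq0.
have pNq0 : p - 'i *: q = 0.
  by rewrite -scaleNr -conj_i -{1}rp -{1}rq -octtauZ -octtauD pq0 octtau0.
have p0 : p = 0.
  apply: (scalerI (two_neq0 R)); rewrite scaler0 scaler_nat mulr2n.
  by rewrite -[RHS]addr0 -{1}pq0 -{1}pNq0 addrACA subrr addr0.
split=> //; apply: (scalerI (neq0Ci C)).
by rewrite scaler0 -[LHS]add0r -{1}p0.
Qed.

Lemma real_oct_polar x : octtau x = x ->
  exists (a : oct C) r,
    [/\ octtau a = a, odot a a = 1, conj r = r & x = r *: a].
Proof.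
move=> rx; have x_ge0 : 0 <= odot x x by rewrite -{1}rx odot_tau_ge0.
have [x0 | x0] := eqVneq (odot x x) 0.
  exists (oscal 1), 0; split.
  - by rewrite octtau_scal rmorph1.
  - by rewrite -onorm_odot /onorm oconj_scal omul_oscal scale1r.
  - exact: rmorph0.
  - by rewrite scale0r; apply: odot_tau_eq0; rewrite rx.
have s0 : sqrtC (odot x x) != 0 by rewrite sqrtC_eq0.
have sr : conj (sqrtC (odot x x)) = sqrtC (odot x x).
  by apply: conjc_fix; rewrite sqrtC_ge0.
exists ((sqrtC (odot x x))^-1 *: x), (sqrtC (odot x x)); split=> //.
- by rewrite octtauZ rx conjc_fix // invr_ge0 sqrtC_ge0.
- by rewrite odotZZ exprVn sqrtCK mulVf.
- by rewrite scalerA mulfV // scale1r.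
Qed.

Lemma xi2_su2 a b X : xi2 (su2_map a b X) =
  a ^+ 2 * xi2 X - 2 * (a * conj b) * ore (x1 X) + conj b ^+ 2 * xi3 X.
Proof. by rewrite su2_mapE /row23 jproj; ring. Qed.

Lemma xi3_su2 a b X : xi3 (su2_map a b X) =
  b ^+ 2 * xi2 X + 2 * (b * conj a) * ore (x1 X) + conj a ^+ 2 * xi3 X.
Proof. by rewrite su2_mapE /row23 jproj; ring. Qed.

Lemma x1_su2 a b X : x1 (su2_map a b X) =
  oscal (a * b * xi2 X - conj b * conj a * xi3 X)
  + (a * conj a) *: x1 X - (b * conj b) *: oconj (x1 X).
Proof.
have bN : - conj b * b = - (b * conj b) by ring.
have abN : - conj b * conj a * xi3 X = - (conj b * conj a * xi3 X) by ring.
by rewrite su2_mapE /row23 jproj bN abN scaleNr.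
Qed.

Lemma x3_su2 a b X :
  x3 (su2_map a b X) = a *: x3 X - conj b *: oconj (x2 X).
Proof. by rewrite su2_mapE /row23 jproj -scaleNr. Qed.

Lemma x1_oct_map c X : x1 (oct_map c X) = omul (oconj c) (x1 X).
Proof. by rewrite oct_mapE. Qed.

Lemma spin1_imag_x1 X : exists f q,
  [/\ Spin1_10 f, octtau q = q & x1 (f X) = 'i *: q].
Proof.
have [p [q [rp rq x1X]]] := real_imag_oct (x1 X).
have [c [r [rc c1 rr pE]]] := real_oct_polar rp.
set X1 := oct_map c X; pose q1 := omul (oconj c) q.
have rq1 : octtau q1 = q1 by rewrite octtauM octtau_conj rc rq.
have x1X1 : x1 X1 = oscal r + 'i *: q1.
  rewrite x1_oct_map x1X pE omulDr !omulZr omul_conj_self c1.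
  by rewrite oscalZ mulr1.
(* In E + conj E, the conjugate of the [xi3] term is - a b conj xi3, so a b appears with the
   coefficient xi2 - conj xi3. *)
have [a [b [ab1 E0]]] := traceless_isotropic (xi2 X1 - conj (xi3 X1)) rr.
set E := a * b * xi2 X1 - conj b * conj a * xi3 X1
         + (a * conj a - b * conj b) * r.
(* The choice of a and b makes the scalar part E of x1 purely imaginary. *)
have EN : conj E = - E.
  apply/eqP; rewrite -addr_eq0 addrC -E0; apply/eqP.
  rewrite /E !(rmorphD, rmorphN, rmorphM) /= !conjcK rr; ring.
have eR : conj (- 'i * E) = - 'i * E.
  rewrite rmorphM rmorphN [X in - X * _]conj_i [X in _ * X]EN.
  by rewrite opprK mulrN mulNr.
exists (su2_map a b \o oct_map c)%VF.
exists (oscal (- 'i * E) + (a * conj a) *: q1 - (b * conj b) *: oconj q1).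
split.
- exact: Spin1_comp (su2_map_Spin1 ab1) (oct_map_Spin1 rc c1).
- rewrite !octtauD octtauN !octtauZ octtau_conj rq1 octtau_scal.
  by rewrite eR (conjc_fix (mul_conj_ge0 a)) (conjc_fix (mul_conj_ge0 b)).
- rewrite comp_lfunE x1_su2 -/X1 x1X1.
  by apply: oct_factor; rewrite mulrN -expr2 sqrCi opprK.
Qed.

(** The sign of [xi3] is recorded because the norm alone determines the surviving entry only up to a
    phase; with the sign it must be 1. *)
Lemma spin1_diagonalize X : freudenthal X X = 0 ->
  exists f, [/\ Spin1_10 f, xi2 (f X) = 0, x1 (f X) = 0 & 0 <= xi3 (f X)].
Proof.
move=> X0; have [f [q [Sf rq x1f]]] := spin1_imag_x1 X.
have [c [r [rc c1 rr qE]]] := real_oct_polar rq.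
set Y := oct_map c (f X); pose z := 'i * r.
have x1Y : x1 Y = oscal z.
  by rewrite x1_oct_map x1f qE !omulZr omul_conj_self c1 !oscalZ mulr1.
have Y0 : freudenthal Y Y = 0.
  by do 2![apply: E6_rank1; first by case: (oct_map_Spin1 rc c1) Sf => ? ? []].
have [w1 [w2 [xi2Y xi3Y zE]]] : exists w1 w2,
    [/\ xi2 Y = w1 ^+ 2, xi3 Y = w2 ^+ 2 & z = w1 * w2].
  apply: sym_rank1; rewrite -odot_oscal -x1Y.
  move: Y0; elim/mkJ_ind: (Y) => ? ? ? ? ? ?.
  by case/(rank1E (two_neq0 R)).
have [a [b [ab1 aw bw]]] := su2_align w1 w2.
exists (su2_map a b \o (oct_map c \o f))%VF; split.
- exact: (Spin1_comp (su2_map_Spin1 ab1) (Spin1_comp (oct_map_Spin1 rc c1) Sf)).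
(* The new entries [xi2], [x1], [xi3] are those of v v^T, where v = (a w1 - conj b w2, b w1 + conj a
   w2) has first coordinate 0. *)
- rewrite 2!comp_lfunE -/Y xi2_su2 xi2Y xi3Y x1Y [ore _]zE.
  transitivity ((a * w1 - conj b * w2) ^+ 2); first by ring.
  by rewrite aw expr0n.
- rewrite 2!comp_lfunE -/Y x1_su2 xi2Y xi3Y x1Y oconj_scal !oscalZ.
  rewrite -oscalD -oscalB zE.
  have -> : a * b * w1 ^+ 2 - conj b * conj a * w2 ^+ 2
    + a * conj a * (w1 * w2) - b * conj b * (w1 * w2)
    = (a * w1 - conj b * w2) * (b * w1 + conj a * w2) by ring.
  by rewrite aw mul0r.
- rewrite 2!comp_lfunE -/Y xi3_su2 xi2Y xi3Y x1Y [ore _]zE.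
  have -> : b ^+ 2 * w1 ^+ 2 + 2 * (b * conj a) * (w1 * w2)
    + conj a ^+ 2 * w2 ^+ 2 = (b * w1 + conj a * w2) ^+ 2 by ring.
  exact: exprn_ge0.
Qed.

Lemma real_imag_scal (k l : C) : conj k = k -> conj l = l ->
  k + 'i * l = 0 -> k = 0 /\ l = 0.
Proof.
move=> rk rl kl0.
have [|||e1 e2] := @real_imag_eq0 (oscal k) (oscal l).
- by rewrite octtau_scal rk.
- by rewrite octtau_scal rl.
- by rewrite oscalZ -oscalD kl0.
by split; [exact: (congr1 (@ore C) e1) | exact: (congr1 (@ore C) e2)].
Qed.

(** If x2 = y and x3 = z, then [oct_map c] makes both conj x2 and x3 multiples of c (z c). To find
    c, write z = p + i q and y = s + i t with real parts: p and q are orthogonal of equal norm, and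
    y z = 0 gives t p = - s q. It is then enough that p c be proportional to conj s. *)
Lemma null_pair y z : odot z z = 0 -> omul y z = 0 -> z != 0 ->
  exists c k, [/\ octtau c = c, odot c c = 1 & oconj y = k *: omul z c].
Proof.
have [p [q [rp rq zE]]] := real_imag_oct z.
have [s [t [rs rt yE]]] := real_imag_oct y.
have i2 : 'i ^+ 2 = -1 :> C := sqrCi C.
rewrite zE odot_addZ i2 mulN1r => zz0 yz0 z0.
have rdot u v : octtau u = u -> octtau v = v -> conj (odot u v) = odot u v.
  by move=> ru rv; rewrite -odot_tau ru rv.
have [pp_qq pq0] : odot p p - odot q q = 0 /\ 2 * odot p q = 0.
  apply: real_imag_scal zz0.
    by rewrite rmorphB /= !rdot.
  by rewrite rmorphM rmorph_nat /= rdot.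
have tp : omul t p = - omul s q.
  have [] : omul s p - omul t q = 0 /\ omul s q + omul t p = 0.
    apply: real_imag_eq0.
    - by rewrite octtauD octtauN !octtauM rs rt rp rq.
    - by rewrite octtauD !octtauM rs rt rp rq.
    rewrite -[RHS]yz0 yE !(omulDl, omulDr) !(omulZl, omulZr) scalerA -expr2 i2.
    by rewrite scaleN1r scalerDr -!addrA; congr (_ + _); rewrite addrC -!addrA.
  by move=> _ /eqP; rewrite addrC addr_eq0 => /eqP.
have N0 : odot p p != 0.
  apply: contra_neq z0 => N0.
  have p0 : p = 0 by apply: odot_tau_eq0; rewrite rp.
  have q0 : q = 0.
    apply: odot_tau_eq0; rewrite rq; apply/eqP.
    by rewrite -oppr_eq0 -sub0r -{1}N0 pp_qq.
  by rewrite p0 q0 scaler0 addr0.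
(* Up to real scalars c is conj p * conj s; the imaginary part of the claimed
   identity then follows from t p = - s q and the orthogonality of p and q. *)
have rc0 : octtau (omul (oconj p) (oconj s)) = omul (oconj p) (oconj s).
  by rewrite octtauM !octtau_conj rp rs.
have [c [r [rc c1 _ c0E]]] := real_oct_polar rc0.
exists c, ((odot p p)^-1 * r); split=> //.
rewrite -scalerA -omulZr -c0E omulDl omulZl omulK_conj.
(* q (conj p conj s) = - p (conj q conj s) = - p conj(s q) = p conj(t p) = p (conj p conj t), using
   first the orthogonality of p and q. *)
have -> : omul q (omul (oconj p) (oconj s)) = odot p p *: oconj t.
  have := omul_alt_swap p q (oconj s); rewrite pq0 scale0r => /eqP.
  rewrite addrC addr_eq0 => /eqP->.
  rewrite -omulK_conj -!oconjM tp -[- omul s q]scaleN1r.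
  by rewrite oconjZ omulZr scaleN1r.
rewrite scalerA mulrC -scalerA -scalerDr scalerA mulVf // scale1r.
by rewrite yE oconjD oconjZ.
Qed.

Lemma x2_oct_map c X : x2 (oct_map c X) = omul (x2 X) (oconj c).
Proof. by rewrite oct_mapE. Qed.

Lemma x3_oct_map c X : x3 (oct_map c X) = omul c (omul (x3 X) c).
Proof. by rewrite oct_mapE. Qed.

Lemma spin1_kill_x3 X : freudenthal X X = 0 -> xi2 X = 0 -> xi3 X = 0 ->
  x1 X = 0 ->
  exists f, [/\ Spin1_10 f, xi2 (f X) = 0, x1 (f X) = 0 & x3 (f X) = 0].
Proof.
move=> XX0 xi2X xi3X x1X.
have [x3X | x3X] := eqVneq (x3 X) 0.
  exists \1%VF; rewrite id_lfunE.
  split; [| exact: xi2X | exact: x1X | exact: x3X].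
  by split; [exact: E6_id | rewrite id_lfunE].
have [n3 m23] : odot (x3 X) (x3 X) = 0 /\ omul (x2 X) (x3 X) = 0.
  move: XX0 xi2X xi3X x1X; elim/mkJ_ind: (X) => a b c x y z.
  case/(rank1E (two_neq0 R)) => _ _ <- yz _; rewrite !jproj => -> _ x0.
  split; first exact: mulr0.
  by apply: (can_inj (@oconjK C)); rewrite yz x0 scaler0 oconj0.
have [c [k [rc c1 x2X]]] := null_pair n3 m23 x3X.
(* After [oct_map c], conj x2 is k times x3, so [su2_map a b] multiplies x3 by a - conj b k. *)
have [a [b [ab1 aw _]]] := su2_align 1 k.
exists (su2_map a b \o oct_map c)%VF; rewrite comp_lfunE.
have [d2 d3 d1] : [/\ xi2 (oct_map c X) = 0, xi3 (oct_map c X) = 0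
                     & x1 (oct_map c X) = 0].
  split; last by rewrite x1_oct_map x1X omulo0.
    by rewrite oct_mapE.
  by rewrite oct_mapE.
split.
- exact: Spin1_comp (su2_map_Spin1 ab1) (oct_map_Spin1 rc c1).
- by rewrite xi2_su2 d2 d3 d1 !mulr0 addr0 subr0.
- by rewrite x1_su2 d2 d3 d1 oconj0 !mulr0 !scaler0 !subr0 addr0.
- rewrite x3_su2 x3_oct_map x2_oct_map oconjM oconjK x2X omulZr scalerA.
  by rewrite -scalerBl -[X in X - _]mulr1 aw scale0r.
Qed.

Lemma freudenthal_jE1_jE1 : freudenthal jE1 jE1 = 0 :> JC R.
Proof.
rewrite {2}/jE1 (freudenthal_jE1 (two_neq0 R)) oppr0 scaler0 mulr0.
exact: erefl.
Qed.

Lemma spin1_spin2_jE1 X : freudenthal X X = 0 -> jherm X X = 1 ->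
  exists f g, [/\ Spin1_10 f, Spin2_10 g & g (f X) = jE1].
Proof.
move=> XX0 X1.
have [f [Sf YY0 Y2 Y1 Y3]] : exists f, [/\ Spin1_10 f,
    freudenthal (f X) (f X) = 0, xi2 (f X) = 0, x1 (f X) = 0 & x3 (f X) = 0].
  have [f [Sf f2 f1 _]] := spin1_diagonalize XX0.
  have ff0 : freudenthal (f X) (f X) = 0 by apply: E6_rank1 XX0; case: Sf.
  have [f3 | f3] := eqVneq (xi3 (f X)) 0.
    have [g [Sg g2 g1 g3]] := spin1_kill_x3 ff0 f2 f3 f1.
    exists (g \o f)%VF; rewrite comp_lfunE.
    split; [exact: (Spin1_comp Sg Sf) | | exact: g2 | exact: g1 | exact: g3].
    by apply: E6_rank1 ff0; case: Sg.
  exists f; split; [exact: Sf | exact: ff0 | exact: f2 | exact: f1 |].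
  move: ff0 f2 f1 f3; elim/mkJ_ind: (f X) => a b c x y z.
  case/(rank1E (two_neq0 R)) => _ _ _ _; rewrite !jproj => + _ x0 c0.
  rewrite x0 omul0o oconj0 => /esym/eqP; rewrite scaler_eq0 (negPf c0) /=.
  exact/eqP.
set Y := f X in YY0 Y1 Y2 Y3 *.
(* Conjugation by cyc_map exchanges the roles of E2 and E1, turning the
   reduction under Spin_1(10) into one under Spin_2(10). *)
have Ec := cyc_map_E6 R; set Z := cyc_map R Y.
have ZZ0 : freudenthal Z Z = 0 by apply: E6_rank1.
have [h [Sh h2 h1 h3]] := spin1_diagonalize ZZ0.
(* Z has the form (0, b, c; x, 0, 0). As h commutes with [peirce], h Z has this form too, and the
   vanishing of its [xi2] and [x1] leaves only [xi3]. *)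
have pZ : peirce Z = Z.
  rewrite /Z cyc_mapE; move: Y1 Y2 Y3; elim/mkJ_ind: (Y) => a b c x y z.
  rewrite /cyc !jproj => -> -> ->; exact: peirceE (two_neq0 R) _ _ _ _ _ _.
have phZ : peirce (h Z) = h Z by rewrite (peirce_Spin1 _ Sh) pZ.
have hZ : h Z = mkJ 0 0 (xi3 (h Z)) 0 0 0.
  move: phZ h2 h1; elim/mkJ_ind: (h Z) => a b c x y z.
  by rewrite (peirceE (two_neq0 R)) !jproj => <- -> ->.
have xi3_1 : xi3 (h Z) = 1.
  have : jherm (h Z) (h Z) = 1.
    case: Sh Sf Ec => [[_ _ hh] _] [[_ _ fh] _] [_ _ ch].
    by rewrite hh ch fh.
  rewrite hZ jherm_mkJ !odoto0 !mulr0 !addr0 mulr0 addr0 add0r jproj.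
  rewrite (conjc_fix h3) -expr2 => /eqP; rewrite sqrf_eq1.
  case/orP=> /eqP // e; move: h3; rewrite e oppr_ge0.
  by rewrite ler10.
pose c' := ((cyc_map R)^-1)%VF.
have cK := (E6_invK Ec).2.
(* [cyc_map] takes E1 to E3 = h Z and E2 to E1, which h fixes; so the conjugate of h takes Y to E1
   and fixes E2. *)
have ce1 : h Z = cyc_map R jE1 by rewrite hZ xi3_1 cyc_mapE.
have ce2 : cyc_map R jE2 = jE1 by rewrite cyc_mapE.
exists f, (c' \o (h \o cyc_map R))%VF; split; first exact: Sf.
- split; first by apply: E6_comp (E6_inv Ec) (E6_comp _ Ec); case: Sh.
  rewrite 2!comp_lfunE ce2; case: Sh => _ ->.
  by rewrite -ce2 cK.
- by rewrite 2!comp_lfunE -/Y -/Z ce1 cK.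
Qed.

End Reduction.

(** * The decomposition of the elements of E6 *)

Theorem theorem7 (R : realType) (alpha : 'End(JC R)) (halpha : E6 alpha) :
  exists alpha1 alpha2 alpha1' : 'End(JC R),
    [/\ Spin1_10 alpha1, Spin2_10 alpha2, Spin1_10 alpha1'
      & alpha = (alpha1 \o alpha2 \o alpha1')%VF].
Proof.
have E1_1 : jherm jE1 jE1 = 1 :> R[i].
  rewrite /jE1 jherm_mkJ !odoto0 !mulr0 !addr0 mulr0 addr0 mulr1.
  exact: rmorph1.
have X0 := E6_rank1 halpha (freudenthal_jE1_jE1 R).
have X1 : jherm (alpha jE1) (alpha jE1) = 1 by case: halpha => _ _ ->.
have [f [g [Sf Sg gfX]]] := spin1_spin2_jE1 X0 X1.
have [Ef _] := Sf; have [Eg gE2] := Sg.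
exists (f^-1)%VF, (g^-1)%VF, (g \o (f \o alpha))%VF; split.
- exact: Spin1_inv.
- split; first exact: E6_inv.
  by rewrite -[in LHS]gE2 (E6_invK Eg).2.
- split; first exact: E6_comp Eg (E6_comp Ef halpha).
  by rewrite 2!comp_lfunE.
- apply/lfunP => X; rewrite !comp_lfunE.
  by rewrite (E6_invK Eg).2 (E6_invK Ef).2.
Qed.
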